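(* Let $W_\Gamma$ be the Coxeter group associated to a Coxeter graph $\Gamma$. If $W_\Gamma$ is infinite and the outer automorphism group $\mathrm{Out}(W_\Gamma)=\mathrm{Aut}(W_\Gamma)/\mathrm{Inn}(W_\Gamma)$ is finite, then $\mathrm{Aut}(W_\Gamma)$ virtually maps onto an infinite special subgroup of $W_\Gamma$; that is, there exist a finite index subgroup $H\subseteq \mathrm{Aut}(W_\Gamma)$, a full subgraph $\Lambda\subseteq\Gamma$ such that $W_\Lambda$ is infinite, and a surjective group homomorphism $H\twoheadrightarrow W_\Lambda$.
   Context: A Coxeter graph is a finite simplicial graph $\Gamma$ with vertex set $V(\Gamma)$, edge set $E(\Gamma)$ (a set of two-element subsets of $V(\Gamma)$) and an edge-labeling $\varphi\colon E(\Gamma)\to\{2,3,4,\ldots\}$. The associated Coxeter group is $$W_\Gamma=\langle V(\Gamma)\mid v^2 \text{ for all } v\in V(\Gamma),\ (vw)^{\varphi(\{v,w\})}\text{ for all }\{v,w\}\in E(\Gamma)\rangle$$ (there is no relation between $v$ and $w$ when they are not adjacent). A full subgraph $\Lambda\subseteq\Gamma$ is one that contains every edge of $\Gamma$ between its vertices. For such $\Lambda$ the subgroup of $W_\Gamma$ generated by $V(\Lambda)$ is canonically isomorphic to the Coxeter group $W_\Lambda$ (with the restricted labeling), is denoted $W_\Lambda$, and is called a special (parabolic) subgroup. *)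

(* Defs.v *)
From HB Require Import structures.
From mathcomp Require Import all_boot.
From mathcomp Require Import mathcomp_extra boolp classical_sets functions.
From mathcomp Require Import cardinality.

Set Implicit Arguments.
Unset Strict Implicit.
Unset Printing Implicit Defensive.

Local Open Scope group_scope.
Local Open Scope quotient_scope.

(* Groups may be infinite, so {group gT} is not available: a subgroup of G is
   a term H : groupClosed G. *)

Section Subgroups.
Variable G : groupType.

Record subg (H : groupClosed G) := Subg {
  subg_val : G;
  subg_mem : subg_val \in H }.

HB.instance Definition _ (H : groupClosed G) := [isSub of subg H for @subg_val H].
HB.instance Definition _ (H : groupClosed G) := [Choice of subg H by <:].

Lemma groupClosedP (H : groupClosed G) : group_closed H.
Proof. by split; [exact: gpred1 | exact: gpredF]. Qed.

HB.instance Definition _ (H : groupClosed G) :=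
  SubChoice_isSubGroup.Build G [in H] (subg H) (groupClosedP H).

Definition generated (A : set G) : {pred G} :=
  [pred x | `[< forall H : groupClosed G,
                  (forall a, A a -> a \in H) -> x \in H >]].

Lemma generated_mul A : mulg_closed (generated A).
Proof.
move=> x y /asboolP Hx /asboolP Hy; apply/asboolP => H AH.
by rewrite gpredM ?Hx ?Hy.
Qed.

Lemma generated_one A : 1 \in generated A.
Proof. by apply/asboolP => H _; exact: gpred1. Qed.

Lemma generated_inv A : invg_closed (generated A).
Proof.
by move=> x /asboolP Hx; apply/asboolP => H AH; rewrite gpredV Hx.
Qed.

HB.instance Definition _ A := isMulClosed.Build G (generated A) (@generated_mul A).
HB.instance Definition _ A := isMul1Closed.Build G (generated A) (generated_one A).
HB.instance Definition _ A := isInvClosed.Build G (generated A) (@generated_inv A).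

Definition lcosets (H : groupClosed G) : set (set G) :=
  range (fun g => [set g * h | h in [set` H]])%classic.

Definition finite_index (H : groupClosed G) : Prop := finite_set (lcosets H).

End Subgroups.

Record Aut (G : groupType) := MkAut {
  aut_fun :> G -> G;
  autM : {morph aut_fun : x y / x * y};
  aut_bij : bijective aut_fun }.

Section Automorphisms.
Variable G : groupType.
Implicit Types f g h : Aut G.

HB.instance Definition _ := gen_eqMixin (Aut G).
HB.instance Definition _ := gen_choiceMixin (Aut G).

Lemma autP f g : f =1 g -> f = g.
Proof.
case: f g => [f fM fb] [g gM gb] /= /funext fg; case: _ / fg in gM gb *.
by rewrite (Prop_irrelevance fM gM) (Prop_irrelevance fb gb).
Qed.

Definition aut_one : Aut G :=
  @MkAut G idfun (fun _ _ => erefl) (inv_bij (fun _ => erefl)).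

Lemma aut_mulM f g : {morph f \o g : x y / x * y}.
Proof. by move=> x y /=; rewrite !autM. Qed.

Definition aut_mul f g : Aut G :=
  MkAut (aut_mulM f g) (bij_comp (aut_bij f) (aut_bij g)).

Lemma aut_inv_ex f : exists g : G -> G, cancel f g /\ cancel g f.
Proof. by case: (aut_bij f) => g; exists g. Qed.

Definition aut_inv_fun f : G -> G := sval (cid (aut_inv_ex f)).

Lemma aut_invK f : cancel f (aut_inv_fun f).
Proof. by rewrite /aut_inv_fun; case: cid => g []. Qed.

Lemma aut_invKV f : cancel (aut_inv_fun f) f.
Proof. by rewrite /aut_inv_fun; case: cid => g []. Qed.

Lemma aut_invM f : {morph aut_inv_fun f : x y / x * y}.
Proof.
by move=> x y; apply: (can_inj (aut_invK f)); rewrite autM !aut_invKV.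
Qed.

Definition aut_inv f : Aut G :=
  MkAut (@aut_invM f) (Bijective (aut_invKV f) (aut_invK f)).

Lemma aut_mulA : associative aut_mul.
Proof. by move=> f g h; exact: autP. Qed.
Lemma aut_mul1g : left_id aut_one aut_mul.
Proof. by move=> f; exact: autP. Qed.
Lemma aut_mulg1 : right_id aut_one aut_mul.
Proof. by move=> f; exact: autP. Qed.
Lemma aut_mulVg : left_inverse aut_one aut_inv aut_mul.
Proof. by move=> f; apply: autP => x /=; exact: aut_invK. Qed.
Lemma aut_mulgV : right_inverse aut_one aut_inv aut_mul.
Proof. by move=> f; apply: autP => x /=; exact: aut_invKV. Qed.

HB.instance Definition _ := isGroup.Build (Aut G)
  aut_mulA aut_mul1g aut_mulg1 aut_mulVg aut_mulgV.

Definition conj_fun (g x : G) : G := g * x * g^-1.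

Lemma conj_funM (g : G) : {morph conj_fun g : x y / x * y}.
Proof. by move=> x y; rewrite /conj_fun !mulgA mulgVK. Qed.

Lemma conj_fun_bij (g : G) : bijective (conj_fun g).
Proof.
exists (fun x => g^-1 * x * g) => x; rewrite /conj_fun.
  by rewrite !mulgA mulVg mul1g mulgVK.
by rewrite !mulgA mulgV mul1g mulgK.
Qed.

Definition conj_aut (g : G) : Aut G := MkAut (conj_funM g) (conj_fun_bij g).

Definition Inn : {pred Aut G} := [pred f | `[< exists g : G, f = conj_aut g >]].

Lemma Inn_mul : mulg_closed Inn.
Proof.
move=> _ _ /asboolP[g ->] /asboolP[h ->]; apply/asboolP; exists (g * h).
by apply: autP => x /=; rewrite /conj_fun invgM !mulgA.
Qed.

Lemma Inn_one : 1 \in Inn.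
Proof.
apply/asboolP; exists 1; apply: autP => x /=.
by rewrite /conj_fun mul1g invg1 mulg1.
Qed.

Lemma Inn_inv : invg_closed Inn.
Proof.
move=> _ /asboolP[g ->]; apply/asboolP; exists g^-1.
apply: (mulgI (conj_aut g)); rewrite mulgV; apply: autP => x /=.
by rewrite /conj_fun invgK !mulgA mulgV mul1g mulgK.
Qed.

HB.instance Definition _ := isMulClosed.Build (Aut G) Inn Inn_mul.
HB.instance Definition _ := isMul1Closed.Build (Aut G) Inn Inn_one.
HB.instance Definition _ := isInvClosed.Build (Aut G) Inn Inn_inv.

(* The underlying set of the quotient Aut(G)/Inn(G). *)
Definition Out : set (set (Aut G)) := lcosets (Inn : groupClosed (Aut G)).

End Automorphisms.

Arguments Inn : clear implicits.
Arguments Out : clear implicits.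

(* The letter (x, true) stands for x and (x, false) for its inverse. *)
Definition word (X : choiceType) : Type := seq (X * bool).

HB.instance Definition _ (X : choiceType) := Choice.on (word X).

Section Presentation.
Variables (X : choiceType) (R : set (word X)).
Implicit Types u v w : word X.

(* Equality in the free group on X modulo the normal closure of R. *)
Inductive pres_eq : word X -> word X -> Prop :=
| pres_refl w : pres_eq w w
| pres_sym u v : pres_eq u v -> pres_eq v u
| pres_trans v u w : pres_eq u v -> pres_eq v w -> pres_eq u w
| pres_cat u u' v v' :
    pres_eq u u' -> pres_eq v v' -> pres_eq (u ++ v) (u' ++ v')
| pres_cancel x b : pres_eq [:: (x, b); (x, ~~ b)] [::]
| pres_rel r : R r -> pres_eq r [::].

Definition pres_eqb : rel (word X) := [rel u v | `[< pres_eq u v >]].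

Lemma pres_eqb_refl : reflexive pres_eqb.
Proof. by move=> w; apply/asboolP; exact: pres_refl. Qed.
Lemma pres_eqb_sym : symmetric pres_eqb.
Proof. by move=> u v; apply/asboolP/asboolP; exact: pres_sym. Qed.
Lemma pres_eqb_trans : transitive pres_eqb.
Proof.
by move=> v u w /asboolP uv /asboolP vw; apply/asboolP; exact: pres_trans vw.
Qed.

Canonical pres_equiv := EquivRel pres_eqb
  pres_eqb_refl pres_eqb_sym pres_eqb_trans.

Definition presented : Type := {eq_quot pres_equiv}.

HB.instance Definition _ := Choice.on presented.

Definition word_class w : presented := \pi_{eq_quot pres_equiv} w.

Lemma word_classP u v : word_class u = word_class v <-> pres_eq u v.
Proof.
split=> [/eqmodP/asboolP//|uv].
by apply/eqmodP/asboolP.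
Qed.

Definition word_repr (a : presented) : word X := repr a.

Lemma word_reprK : cancel word_repr word_class.
Proof. by move=> a; exact: reprK. Qed.

Lemma repr_word_class w : pres_eq (word_repr (word_class w)) w.
Proof. by apply/word_classP; rewrite word_reprK. Qed.

Definition word_inv w : word X := rev [seq (l.1, ~~ l.2) | l <- w].

Lemma word_invK : involutive word_inv.
Proof.
move=> w; rewrite /word_inv map_rev revK -map_comp -[RHS]map_id.
by apply: eq_map => -[x b] /=; rewrite negbK.
Qed.

Lemma word_inv_cat u v : word_inv (u ++ v) = word_inv v ++ word_inv u.
Proof. by rewrite /word_inv map_cat rev_cat. Qed.

Lemma word_catV w : pres_eq (w ++ word_inv w) [::].
Proof.
elim: w => [|[x b] w IHw]; first exact: pres_refl.
rewrite -cat1s word_inv_cat -catA [w ++ _]catA.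
apply: (pres_trans _ (pres_cancel x b)).
apply: (@pres_cat [:: (x, b)] [:: (x, b)] _ (word_inv [:: (x, b)])).
  exact: pres_refl.
exact: (@pres_cat _ [::] _ _ IHw (pres_refl _)).
Qed.

Lemma word_catVl w : pres_eq (word_inv w ++ w) [::].
Proof. by rewrite -{2}[w]word_invK; exact: word_catV. Qed.

Lemma word_inv_eq u v : pres_eq u v -> pres_eq (word_inv u) (word_inv v).
Proof.
move=> uv; rewrite -[word_inv u]cats0.
apply: (@pres_trans (word_inv u ++ (v ++ word_inv v))).
  by apply: pres_cat; [exact: pres_refl | apply/pres_sym/word_catV].
rewrite catA -[word_inv v in X in pres_eq _ X]cat0s.
apply: pres_cat; last exact: pres_refl.
apply: (pres_trans _ (word_catVl u)).
by apply: pres_cat; [exact: pres_refl | exact: pres_sym].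
Qed.

Definition pres_one : presented := word_class [::].
Definition pres_mul (a b : presented) : presented :=
  word_class (word_repr a ++ word_repr b).
Definition pres_inv (a : presented) : presented :=
  word_class (word_inv (word_repr a)).

Lemma pres_mulE u v :
  pres_mul (word_class u) (word_class v) = word_class (u ++ v).
Proof. by apply/word_classP/pres_cat; exact: repr_word_class. Qed.

Lemma pres_invE u : pres_inv (word_class u) = word_class (word_inv u).
Proof. by apply/word_classP/word_inv_eq; exact: repr_word_class. Qed.

Lemma pres_mulA : associative pres_mul.
Proof.
move=> a b c; rewrite -[a]word_reprK -[b]word_reprK -[c]word_reprK.
by rewrite !pres_mulE catA.
Qed.
Lemma pres_mul1g : left_id pres_one pres_mul.
Proof. by move=> a; rewrite -[a]word_reprK pres_mulE. Qed.
Lemma pres_mulg1 : right_id pres_one pres_mul.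
Proof. by move=> a; rewrite -[a]word_reprK pres_mulE cats0. Qed.
Lemma pres_mulVg : left_inverse pres_one pres_inv pres_mul.
Proof.
move=> a; rewrite -[a]word_reprK pres_invE pres_mulE.
by apply/word_classP; exact: word_catVl.
Qed.
Lemma pres_mulgV : right_inverse pres_one pres_inv pres_mul.
Proof.
move=> a; rewrite -[a]word_reprK pres_invE pres_mulE.
by apply/word_classP; exact: word_catV.
Qed.

HB.instance Definition _ := isGroup.Build presented
  pres_mulA pres_mul1g pres_mulg1 pres_mulVg pres_mulgV.

Definition pres_gen (x : X) : presented := word_class [:: (x, true)].

End Presentation.

(* Only the values of [label] on [edges] are meaningful. *)
Record coxeter_graph := CoxeterGraph {
  vertices :> finType;
  edges : {set {set vertices}};
  label : {set vertices} -> nat;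
  edge_card : forall e, e \in edges -> #|e| = 2;
  label_ge2 : forall e, e \in edges -> 2 <= label e }.

Section CoxeterGroup.
Variable Gamma : coxeter_graph.

Definition coxeter_relators : set (word Gamma) := fun r =>
  (exists v : Gamma, r = [:: (v, true); (v, true)]) \/
  (exists v w : Gamma, [set v; w]%SET \in edges Gamma /\
    r = flatten (nseq (label [set v; w]%SET) [:: (v, true); (w, true)])).

Definition coxeter_group : groupType := presented coxeter_relators.

Definition coxeter_gen (v : Gamma) : coxeter_group :=
  pres_gen coxeter_relators v.

Record subgraph := Subgraph {
  sub_vertices : {set Gamma};
  sub_edges : {set {set Gamma}};
  sub_edgesP : forall e,
    e \in sub_edges -> e \in edges Gamma /\ e \subset sub_vertices }.

Definition full (Lambda : subgraph) : Prop :=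
  forall e, e \in edges Gamma -> e \subset sub_vertices Lambda ->
    e \in sub_edges Lambda.

Definition special_subgroup (Lambda : subgraph) : groupClosed coxeter_group :=
  generated [set coxeter_gen v | v in [set` sub_vertices Lambda]]%classic.

End CoxeterGroup.

(* Main.v *)
(* Take H = Inn(W), which has finite index because Out(W) is finite; as
   Inn(W) = W/Z(W), it suffices to find a surjection of W onto an infinite
   special subgroup that kills the center.

   By Tits' cocycle, the reflections occurring an odd number of times among the
   s_1 ... s_(i-1) s_i s_(i-1) ... s_1 depend only on the element w = s_1 ... s_k
   and not on the word; they form the inversion set N(w), with
   N(ab) = N(a) + a N(b) a^-1 (symmetric difference).  Hence N(z) is finite and
   invariant under conjugation when z is central.  Let J be the set of
   generators that are inversions of some central element.  Comparing N(z) with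
   the dihedral subgroup <s, t> shows that each s in J commutes with each t not
   in J, and the labels between them are even because s <> t.  So W retracts
   onto the special subgroup W' on the complement of J by killing J, and
   W = W_J W'.  The group W_J is finite, its reflections being inversions of
   finitely many central elements, so W' is infinite; and the retraction kills a
   central z because the first letter of a reduced word for its image would be
   an inversion of z outside J. *)

Require Import Defs.
From HB Require Import structures.
From mathcomp Require Import all_boot.
From mathcomp Require Import boolp classical_sets functions cardinality.

Set Implicit Arguments.
Unset Strict Implicit.
Unset Printing Implicit Defensive.

Local Open Scope group_scope.

(** The elements satisfying [P] form a subgroup that contains [A]. *)
Lemma generated_ind (G : groupType) (A : set G) (P : G -> Prop) :
    P 1 -> (forall x y, P x -> P y -> P (x * y)) ->
    (forall x, P x -> P x^-1) -> (forall a, A a -> P a) ->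
  forall x, x \in generated A -> P x.
Proof.
move=> P1 PM PV PA x /asboolP Ax.
pose S : {pred G} := [pred y | `[< P y >]].
have SM : mulg_closed S.
  by move=> y z /asboolP Py /asboolP Pz; apply/asboolP/PM.
have S1 : 1 \in S by apply/asboolP.
have SV : invg_closed S by move=> y /asboolP Py; apply/asboolP/PV.
pose H : groupClosed G := HB.pack S (isMulClosed.Build G S SM)
  (isMul1Closed.Build G S S1) (isInvClosed.Build G S SV).
by apply/asboolP/(Ax H) => a Aa; apply/asboolP/PA.
Qed.

(** * Words, reflection sequences and Tits' inversion cocycle *)

Section CoxeterGroupTheory.
Variable Gamma : coxeter_graph.

Local Notation W := (coxeter_group Gamma).
Local Notation cls := (@word_class Gamma (@coxeter_relators Gamma)).
Local Notation peq := (@pres_eq Gamma (@coxeter_relators Gamma)).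
Local Notation gen := (@coxeter_gen Gamma).

Lemma cls_cat u v : cls (u ++ v) = (cls u : W) * cls v.
Proof. by rewrite -pres_mulE. Qed.

Lemma cls_nil : cls [::] = 1 :> W. Proof. by []. Qed.

Lemma gen_mulgg v : gen v * gen v = 1.
Proof.
rewrite /coxeter_gen /pres_gen -cls_cat; apply/word_classP/pres_rel.
by left; exists v.
Qed.

Lemma gen_inv v : (gen v)^-1 = gen v.
Proof. exact/mulg1_eq/gen_mulgg. Qed.

Lemma cls_cons (l : Gamma * bool) q : cls (l :: q) = gen l.1 * cls q.
Proof.
rewrite -cat1s cls_cat; congr (_ * _); case: l => x [] //=.
apply: (mulgI (gen x)); rewrite gen_mulgg /coxeter_gen /pres_gen -cls_cat.
exact/word_classP/pres_cancel.
Qed.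

Lemma cls_repr (w : W) : cls (word_repr w) = w.
Proof. exact: word_reprK. Qed.

Lemma gen_edge v w : [set v; w]%SET \in edges Gamma ->
  (gen v * gen w) ^+ label [set v; w]%SET = 1.
Proof.
move=> vw; have <- : cls (flatten (nseq (label [set v; w]%SET)
    [:: (v, true); (w, true)])) = 1 :> W.
  by apply/word_classP/pres_rel; right; exists v, w.
elim: (label _) => [|n IHn] //.
by rewrite expgS IHn [flatten _]/= !cls_cons mulgA.
Qed.

(* For q = s_1 ... s_k, the i-th entry is s_1 ... s_(i-1) s_i s_(i-1) ... s_1;
   recall that x ^ y = y^-1 * x * y, and that generators are involutions. *)
Fixpoint refls (q : word Gamma) : seq W :=
  if q is l :: q' then gen l.1 :: [seq r ^ gen l.1 | r <- refls q'] else [::].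

Lemma refls_cat u v :
  refls (u ++ v) = refls u ++ [seq r ^ (cls u : W)^-1 | r <- refls v].
Proof.
elim: u => [|l u IHu] /=.
  by rewrite invg1 -[LHS]map_id; apply: eq_map => r; rewrite conjg1.
rewrite IHu map_cat -map_comp; congr (_ :: _ ++ _); apply: eq_map => r /=.
by rewrite cls_cons invgM gen_inv conjgM.
Qed.

Lemma count_mem_conjg (r a : W) s :
  count_mem r [seq x ^ a^-1 | x <- s] = count_mem (r ^ a) s.
Proof.
rewrite count_map; apply: eq_count => x /=.
by rewrite -(inj_eq (@conjg_inj _ a)) conjgKV.
Qed.

Lemma refls_dihedral v w n : let c := gen v * gen w in
  refls (flatten (nseq n [:: (v, true); (w, true)])) =
  [seq c ^+ j * gen v | j <- iota 0 n.*2].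
Proof.
move=> c; elim: n => [|n IHn] //.
rewrite doubleS [flatten _]/= [refls _]/= IHn /= mul1g; congr [:: _, _ & _].
  by rewrite /c conjgE gen_inv expg1 !mulgA.
rewrite (iotaDl 2 0) -!map_comp; apply: eq_map => j /=.
have -> : (2 + j = j.+2)%N by [].
by rewrite -conjgM conjgE invgM !gen_inv -/c expgS expgSr !mulgA.
Qed.

Lemma odd_count_refls u v : peq u v ->
  forall r, odd (count_mem r (refls u)) = odd (count_mem r (refls v)).
Proof.
elim=> {u v} // [u v u' _ IHu _ IHv r|u u' v v' uu' IHu _ IHv r|x b r|q].
- by rewrite IHu.
- rewrite !refls_cat !count_cat !oddD !count_mem_conjg IHu IHv.
  by have -> : cls u = cls u' :> W by apply/word_classP.
- by rewrite /= conjgE gen_inv gen_mulgg mulg1; case: eqP.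
case=> [[v -> r]|[v [w [vw ->]]] r].
  by rewrite /= conjgE gen_inv gen_mulgg mulg1; case: eqP.
(* With m the label, [(gen v * gen w) ^+ m = 1] makes the second half of these 2m reflections repeat
   the first, so all multiplicities are even. *)
rewrite refls_dihedral -addnn iotaD add0n map_cat count_cat.
rewrite -{2}[label _]addn0 iotaDl -map_comp.
rewrite [in X in odd (_ + X)](@eq_map _ _ _
    (fun j => (gen v * gen w) ^+ j * gen v)).
  by rewrite addnn odd_double.
by move=> j /=; rewrite expgnDr gen_edge // mul1g.
Qed.

(* By [odd_count_refls], any word for [w] could be used instead of
   [word_repr w]. *)
Definition inversion (w r : W) : bool :=
  odd (count_mem r (refls (word_repr w))).

Lemma inversion_cls q r : inversion (cls q) r = odd (count_mem r (refls q)).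
Proof. exact/odd_count_refls/repr_word_class. Qed.

Lemma inversionM a b r :
  inversion (a * b) r = inversion a r (+) inversion b (r ^ a).
Proof.
rewrite -{1}(cls_repr a) -{1}(cls_repr b) -cls_cat inversion_cls refls_cat.
by rewrite count_cat oddD count_mem_conjg cls_repr.
Qed.

(** * Exchange, deletion and reduced words *)

Lemma inversion_refls q r : inversion (cls q) r -> r \in refls q.
Proof. by rewrite inversion_cls -has_pred1 has_count; case: count. Qed.

Lemma uniq_inversion q r :
  uniq (refls q) -> inversion (cls q) r = (r \in refls q).
Proof. by move=> Uq; rewrite inversion_cls count_uniq_mem // oddb. Qed.

(** Deleting the letter behind the entry [r] amounts to multiplying by [r] on the left, as
    generators are involutions. *)
Lemma refls_exchange q r : r \in refls q ->
  exists q', [/\ subseq q' q, (size q' < size q)%N & cls q' = r * cls q].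
Proof.
elim: q r => // l q IHq r; rewrite inE => /predU1P[->|/mapP[r' /IHq[q'] []]].
  by exists q; rewrite subseq_cons cls_cons mulgA gen_mulgg mul1g.
move=> qq' lt_q' eq_q' ->; exists (l :: q'); rewrite /= eqxx; split=> //.
rewrite !cls_cons eq_q' conjgE gen_inv -!mulgA (mulgA (gen _) (gen _)).
by rewrite gen_mulgg mul1g.
Qed.

(** If the first generator recurs as a later entry, exchange in the tail absorbs it and drops a
    second letter. *)
Lemma refls_deletion q : ~~ uniq (refls q) ->
  exists q', [/\ subseq q' q, (size q' < size q)%N & cls q' = cls q].
Proof.
elim: q => // l q IHq /=; rewrite negb_and negbK => /orP[/mapP[r]|].
  move=> qr eq_r; have {eq_r} eq_r : r = gen l.1.
    by apply: (@conjg_inj _ (gen l.1)); rewrite -eq_r conjgE mulKg.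
  have [q' [qq' lt_q' eq_q']] := refls_exchange qr; exists q'.
  rewrite cls_cons -eq_r; split=> //; last exact: ltnW.
  exact: subseq_trans qq' (subseq_cons _ _).
rewrite map_inj_uniq; last exact: conjg_inj.
case/IHq=> q' [qq' lt_q' eq_q']; exists (l :: q'); rewrite /= eqxx.
by rewrite !cls_cons eq_q'.
Qed.

(** A repetition-free [refls] serves as reducedness; a subword keeps its letters within any
    prescribed set. *)
Lemma reduced_subword q :
  exists q', [/\ subseq q' q, cls q' = cls q & uniq (refls q')].
Proof.
have [n] := ubnP (size q); elim: n q => // n IHn q /ltnSE lt_q.
have [Uq|/refls_deletion[q' [qq' lt_q' eq_q']]] := boolP (uniq (refls q)).
  by exists q.
have [|p [pq' eq_p Up]] := IHn q'; first exact: leq_trans lt_q.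
by exists p; rewrite eq_p (subseq_trans pq').
Qed.

Lemma cls_rev q : cls (rev q) = (cls q : W)^-1.
Proof.
elim: q => [|l q IHq]; first by rewrite invg1.
by rewrite rev_cons -cats1 cls_cat IHq !cls_cons mulg1 invgM gen_inv.
Qed.

Lemma cls_conjg d q : (cls d : W) ^ cls q = cls (rev q ++ d ++ q).
Proof. by rewrite !cls_cat cls_rev conjgE. Qed.

Lemma mem_refls (P : pred (Gamma * bool)) q r : all P q -> r \in refls q ->
  exists p l, [/\ all P p, P l & r = gen l.1 ^ cls p].
Proof.
elim: q r => // l q IHq r /= /andP[Pl Pq].
rewrite inE => /predU1P[->|/mapP[r' /(IHq _ Pq)[p [l' [Pp Pl' ->]]] ->]].
  by exists [::], l; rewrite conjg1.
exists (rcons p l), l'; rewrite all_rcons Pl Pp; split=> //.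
by rewrite -cats1 cls_cat cls_cons mulg1 conjgM.
Qed.

(** * Inversions of central elements *)

Definition central (z : W) : Prop := forall x, commute z x.

(** The cocycle expansions of N(az) and N(za) agree, and their terms N(a) cancel. *)
Lemma inversion_central z r a :
  central z -> inversion z (r ^ a) = inversion z r.
Proof.
move=> Zz; have := inversionM a z r; rewrite -Zz inversionM.
have -> : r ^ z = r by rewrite conjgE -Zz mulKg.
by rewrite addbC => /addbI ->.
Qed.

(* Write z = u v with u in <s, t> and v shortest in the coset <s, t> z, so that
   z and u have the same inversions in <s, t>.  A reduced word for u starts
   with s but not with t; were it longer, it would start with s t and s t s, a
   conjugate of t, would be an inversion of z.  So u = s, and t s t, being a
   conjugate of s, can only be s. *)
Lemma central_inversion_commute z s t : central z ->
  inversion z (gen s) -> ~~ inversion z (gen t) -> commute (gen s) (gen t).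
Proof.
move=> Zz zs zt; pose D := all (fun l : Gamma * bool => l.1 \in [:: s; t]).
have Dcat p d : D p -> D d -> D (p ++ d) by rewrite /D all_cat => -> ->.
have Drev p : D p -> D (rev p) by rewrite /D all_rev.
have {Dcat Drev} [p [q [Dp eq_z q_min]]] : exists p q, [/\ D p, z = cls p * cls q
    & forall d, D d -> ~~ inversion (cls q) (cls d)].
  pose dec n := exists p q, [/\ D p, z = cls p * cls q & size q = n].
  have [|n /asboolP[p [q [Dp eq_z szq]]] n_min] :=
      @ex_minnP [pred n | `[< dec n >]].
    exists (size (word_repr z)); apply/asboolP; exists [::], (word_repr z).
    by rewrite cls_repr mul1g.
  (* By exchange, an inversion of [cls q] in <s, t> could be moved into [p], leaving a shorter
     [q]. *)
  exists p, q; split=> // d Dd; apply/negP => /inversion_refls/refls_exchange.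
  case=> q' [_ lt_q' eq_q']; suff: (n <= size q')%N by rewrite leqNgt -szq lt_q'.
  apply/n_min/asboolP; exists (p ++ rev d), q'; split=> //.
    by apply: Dcat => //; exact: Drev.
  by rewrite cls_cat cls_rev eq_q' eq_z -mulgA mulKg.
have zE d : D d -> inversion z (cls d) = inversion (cls p) (cls d).
  move=> Dd; rewrite eq_z inversionM cls_conjg (negbTE (q_min _ _)) ?addbF //.
  by rewrite /D !all_cat all_rev -/(D p) -/(D d) Dp Dd.
have [p' [p'p eq_p Up]] := reduced_subword p.
have {p'p} Dp' : D p' by apply/allP => l /(mem_subseq p'p); exact: (allP Dp).
have {}zE d : D d -> inversion z (cls d) = (cls d \in refls p').
  by move=> Dd; rewrite zE // -eq_p uniq_inversion.
have genE x : gen x = cls [:: (x, true)] by [].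
move: (zs) (zt); rewrite !genE !zE; try by rewrite /D /= !inE eqxx ?orbT.
rewrite -!genE; move: Up Dp' zE; case: p' {eq_p} => // -[x b] p' Up /andP[/=].
rewrite 2!inE => xst Dp'; move: xst Up.
case/orP=> /eqP-> => [|_ _]; last by rewrite mem_head.
have conjE v w : gen v ^ gen w = cls [:: (w, true); (v, true); (w, true)] :> W.
  by rewrite !cls_cons cls_nil mulg1 conjgE gen_inv.
have Dconj v w : D [:: (w, true); (v, true); (w, true)] =
    (v \in [:: s; t]) && (w \in [:: s; t]).
  by rewrite /D /= andbT andbCA andbb.
case: p' Dp' => [|[y c] p'] /=.
  move=> _ _ /(_ [:: (t, true); (s, true); (t, true)]); rewrite Dconj -conjE.
  rewrite inversion_central // zs mem_seq1 !inE !eqxx orbT.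
  by move=> /(_ isT)/esym fix_s _ _; apply/commgP; rewrite -conjg_fix.
rewrite 2!inE => /andP[/orP[]/eqP-> _] Up zE _ _.
  have ss : gen s ^ gen s = gen s by rewrite conjgE mulKg.
  by move: Up; rewrite ss mem_head.
move: zt; rewrite -(inversion_central _ (gen s)) // conjE zE.
  by rewrite -conjE !inE eqxx orbT.
by rewrite Dconj !inE !eqxx orbT.
Qed.

Lemma gen_expg v n : gen v ^+ n = gen v ^+ odd n.
Proof.
rewrite -{1}(odd_double_half n) expgnDr -muln2 mulnC expgnA expg2 gen_mulgg.
by rewrite expg1n mulg1.
Qed.

(** * Retraction onto a special subgroup *)

Section Retraction.
Variable A : {set Gamma}.

Definition keep (q : word Gamma) : word Gamma := [seq l <- q | l.1 \in A].

Hypothesis even_boundary : forall s t, s \in A -> t \notin A ->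
  [set s; t]%SET \in edges Gamma -> ~~ odd (label [set s; t]%SET).

(** The delicate relators are those on an edge leaving [A]: they become s^m with m even, hence
    trivial. *)
Lemma cls_keep u v : peq u v -> cls (keep u) = cls (keep v).
Proof.
elim=> {u v} // [u v v' _ -> _ -> //|u u' v v' _ IHu _ IHv|x b|q].
- by rewrite /keep !filter_cat !cls_cat IHu IHv.
- by rewrite /keep /=; case: (x \in A) => //; exact/word_classP/pres_cancel.
case=> [[v ->]|[v [w [vw ->]]]].
  by rewrite /keep /=; case: (v \in A) => //; rewrite !cls_cons mulg1 gen_mulgg.
set m := label _ in vw *.
have -> : cls (keep (flatten (nseq m [:: (v, true); (w, true)]))) =
    cls (keep [:: (v, true); (w, true)]) ^+ m :> W.
  elim: m => [|m IHm] //.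
  by rewrite expgS -IHm -cls_cat /keep -filter_cat.
have odd_m s t : s \in A -> t \notin A -> [set v; w]%SET = [set s; t]%SET ->
    gen s ^+ m = 1.
  move=> As At eq_vw; rewrite gen_expg /m eq_vw.
  by rewrite (negbTE (even_boundary As At _)) -?eq_vw.
rewrite /keep /=.
have [Av|nAv] := boolP (v \in A); have [Aw|nAw] := boolP (w \in A).
- by rewrite !cls_cons mulg1 /m gen_edge.
- by rewrite cls_cons mulg1 (odd_m v w).
- by rewrite cls_cons mulg1 (odd_m w v) // finset.setUC.
- by rewrite expg1n.
Qed.

Definition retract (w : W) : W := cls (keep (word_repr w)).

Lemma retract_cls q : retract (cls q) = cls (keep q).
Proof. exact/cls_keep/repr_word_class. Qed.

Lemma retractM : {morph retract : a b / a * b}.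
Proof.
move=> a b; rewrite -(cls_repr a) -(cls_repr b) -cls_cat !retract_cls.
by rewrite /keep filter_cat cls_cat.
Qed.

Lemma retract_gen v : v \in A -> retract (gen v) = gen v.
Proof. by move=> Av; rewrite retract_cls /keep /= Av. Qed.

Lemma retract1 : retract 1 = 1.
Proof. by rewrite -cls_nil retract_cls. Qed.

Lemma retractV a : retract a^-1 = (retract a)^-1.
Proof. by apply/esym/mulg1_eq; rewrite -retractM mulgV retract1. Qed.

End Retraction.

(** * The generators inverted by central elements *)

Definition central_support : {set Gamma} :=
  [set v | `[< exists2 z, central z & inversion z (gen v) >]]%SET.
Local Notation J := central_support.

Lemma central_supportP v :
  reflect (exists2 z, central z & inversion z (gen v)) (v \in J).
Proof. by rewrite finset.inE; exact: asboolP. Qed.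

Lemma central_support_gen s t : s \in J -> gen s = gen t -> t \in J.
Proof.
move=> /central_supportP[z Zz zs] st.
by apply/central_supportP; exists z; rewrite -?st.
Qed.

Lemma central_support_commute s t : s \in J -> t \notin J ->
  commute (gen s) (gen t).
Proof.
move=> /central_supportP[z Zz zs] Jt.
apply: (central_inversion_commute Zz zs); apply: contra Jt => zt.
by apply/central_supportP; exists z.
Qed.

(** As s and t commute, an odd label m would turn (st)^m = 1 into st = 1, so s = t in W, although
    only one of them is in [J]. *)
Lemma central_support_even s t : s \in ~: J -> t \notin ~: J ->
  [set s; t]%SET \in edges Gamma -> ~~ odd (label [set s; t]%SET).
Proof.
rewrite !finset.in_setC negbK => Js Jt st; apply/negP => odd_st.
have st1 := gen_edge st; have /esym c_ts := central_support_commute Jt Js.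
move: st1; rewrite expgMn // (gen_expg s) (gen_expg t) odd_st => /mulg1_eq.
by rewrite gen_inv => /esym/(central_support_gen Jt); apply/negP.
Qed.

Lemma cls_split q : cls q =
  cls [seq l <- q | l.1 \in J] * cls (keep (~: J) q) :> W.
Proof.
elim: q => [|l q IHq]; first by rewrite mulg1.
rewrite /keep /= finset.in_setC cls_cons IHq.
case: ifPn => Jl /=; first by rewrite cls_cons mulgA.
rewrite cls_cons !mulgA; congr (_ * _).
(* The letter [l] outside [J] commutes past each letter of [J]. *)
elim: q {IHq} => [|s q IHq] /=; first by rewrite mulg1 mul1g.
case: ifP => // Js; rewrite cls_cons -mulgA -IHq !mulgA.
by rewrite (central_support_commute Js Jl).
Qed.


Lemma commute_central_support p t : all (fun l : Gamma * bool => l.1 \in J) p ->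
  t \notin J -> commute (gen t) (cls p).
Proof.
move=> + Jt; elim: p => [|l p IHp] /=; first by move=> _; exact: commute1.
case/andP=> Jl /IHp tp; rewrite cls_cons; apply: commuteM => //.
by apply/commute_sym; exact: central_support_commute.
Qed.

Lemma retract_central z : central z -> retract (~: J) z = 1.
Proof.
move=> Zz; rewrite /retract; have := cls_split (word_repr z); rewrite cls_repr.
have [b [sub_b <- Ub]] := reduced_subword (keep (~: J) (word_repr z)).
set a := [seq l <- _ | _] => eq_z; case: b sub_b Ub eq_z => // l b sub_b Ub eq_z.
have Ja : all (fun l => l.1 \in J) a by exact: filter_all.
have Jl : l.1 \notin J.
  have /(mem_subseq sub_b) : l \in l :: b by rewrite mem_head.
  by rewrite mem_filter finset.in_setC => /andP[].
case/negP: (Jl); apply/central_supportP; exists z => //.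
have /conjg_fixP tfix : [~ gen l.1, cls a] == 1.
  by apply/commgP; exact: commute_central_support.
rewrite eq_z inversionM tfix (uniq_inversion _ Ub) mem_head.
(* An inversion of [cls a] is conjugate, by a word over [J], to a generator from [J]; [gen l.1]
   commutes with that word, so it would equal that generator. *)
suff /negbTE-> : ~~ inversion (cls a) (gen l.1) by [].
apply/negP => /inversion_refls/(mem_refls Ja)[p [s [Jp Js eq_t]]].
case/negP: (Jl); apply: central_support_gen Js _.
have /conjg_fixP <- : [~ gen l.1, (cls p)^-1] == 1.
  by apply/commgP/commuteV; exact: commute_central_support.
by rewrite eq_t conjgK.
Qed.

(* Each s in J is an inversion of some central z_s, hence so are all its
   conjugates: the entries of the (repetition-free) reflection list of a reduced
   word over J lie in the finite set of inversions of the z_s, which bounds the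
   length of the word. *)
Lemma finite_central_support :
  finite_set [set cls p | p in [set p | all (fun l => l.1 \in J) p]]%classic.
Proof.
have /choice[z zP] : forall s, exists z,
    s \in J -> central z /\ inversion z (gen s).
  move=> s; have [/central_supportP[z Zz zs]|] := boolP (s \in J); last first.
    by exists 1.
  by exists z.
pose M := flatten [seq refls (word_repr (z s)) | s <- enum Gamma].
pose B := (size M).-bseq (Gamma * bool)%type.
apply: (@sub_finite_set _ _ (range (fun p : B => cls p))); last first.
  exact/finite_image/finite_finset.
move=> _ [p /= Jp <-]; have [q [sub_q <- Uq]] := reduced_subword p.
have {p Jp sub_q} Jq : all (fun l => l.1 \in J) q.
  by apply/allP => l /(mem_subseq sub_q)/(allP Jp).
suff le_q : (size q <= size M)%N by exists (Bseq le_q).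
have <- : size (refls q) = size q.
  by elim: (q) => //= l q' <-; rewrite size_map.
apply: uniq_leq_size => // r /(mem_refls Jq)[p [l [_ /zP[Zz zl] ->]]].
apply/flattenP; exists (refls (word_repr (z l.1))).
  by apply: map_f; rewrite mem_enum.
by apply: inversion_refls; rewrite cls_repr inversion_central.
Qed.

(** * The special subgroup on the complement of [J] *)

Lemma central_complement_edges e :
  e \in [set e in edges Gamma | e \subset ~: J]%SET ->
  e \in edges Gamma /\ e \subset ~: J.
Proof. by rewrite finset.inE => /andP. Qed.

Definition central_complement : subgraph Gamma :=
  Subgraph central_complement_edges.

Local Notation K := (special_subgroup central_complement).

Lemma full_central_complement : full central_complement.
Proof. by move=> e Ee sub_e; rewrite finset.inE Ee. Qed.

Lemma retract_special w : retract (~: J) w \in K.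
Proof.
rewrite /retract; elim: (word_repr w) => [|l q IHq]; first exact: gpred1.
rewrite /keep /=; case: ifP => // Jl; rewrite cls_cons gpredM //.
by apply/asboolP => H; apply; exists l.1.
Qed.

Lemma retract_id w : w \in K -> retract (~: J) w = w.
Proof.
have even := central_support_even.
move: w; apply: generated_ind => [|x y fx fy|x fx|_ [v Jv <-]].
- exact: retract1.
- by rewrite retractM // fx fy.
- by rewrite retractV // fx.
- exact: retract_gen.
Qed.

(** By [cls_split], W is the product of a finite set and [K]. *)
Lemma infinite_special : infinite_set [set: W]%classic ->
  infinite_set [set: subg K]%classic.
Proof.
move=> + finK; apply.
apply: sub_finite_set (finite_image2 (fun a (b : subg K) => a * subg_val b)
  finite_central_support finK) => w _.
exists (cls [seq l <- word_repr w | l.1 \in J]).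
  by exists [seq l <- word_repr w | l.1 \in J] => //; exact: filter_all.
exists (Subg (retract_special w)) => //=.
by rewrite -cls_split cls_repr.
Qed.

(** * The homomorphism from the inner automorphisms *)

Definition inner_retract (phi : subg (Inn W)) : subg K :=
  Subg (retract_special (sval (cid (asboolP _ (subg_mem phi))))).

(** Elements inducing the same conjugation differ by a central factor, which the retraction kills,
    so the conjugator chosen in [inner_retract] is immaterial. *)
Lemma inner_retractE (phi : subg (Inn W)) g : subg_val phi = conj_aut g ->
  subg_val (inner_retract phi) = retract (~: J) g.
Proof.
rewrite /inner_retract /=; case: cid => h /= -> eq_hg.
suff /retract_central : central (g^-1 * h).
  rewrite retractM; last exact: central_support_even.
  rewrite retractV; last exact: central_support_even.
  by move=> /mulg1_eq; rewrite invgK.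
move=> x; apply: (mulgI g); rewrite !mulgA mulgV mul1g.
have := congr1 (fun phi : Aut W => phi x) eq_hg.
by rewrite /= /conj_fun => <-; rewrite mulgVK.
Qed.

Lemma inner_retractM : {morph inner_retract : phi psi / phi * psi}.
Proof.
move=> phi psi; apply: val_inj.
have /asboolP[g eq_g] := subg_mem phi; have /asboolP[h eq_h] := subg_mem psi.
rewrite valM.
have -> : \val (inner_retract (phi * psi)) = retract (~: J) (g * h).
  apply: inner_retractE; rewrite [LHS]valM; apply: autP => x.
  by rewrite /= eq_g eq_h /= /conj_fun invgM !mulgA.
rewrite retractM; last exact: central_support_even.
by congr (_ * _); apply/esym; exact: inner_retractE.
Qed.

HB.instance Definition _ :=
  isMultiplicative.Build (subg (Inn W)) (subg K) inner_retract inner_retractM.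

End CoxeterGroupTheory.

Theorem lemma1p4 (Gamma : coxeter_graph)
    (W_infinite : infinite_set [set: coxeter_group Gamma]%classic)
    (Out_finite : finite_set (Out (coxeter_group Gamma))) :
  exists (H : groupClosed (Aut (coxeter_group Gamma)))
         (Lambda : subgraph Gamma)
         (f : {multiplicative subg H -> subg (special_subgroup Lambda)}),
    [/\ finite_index H,
        full Lambda,
        infinite_set [set: subg (special_subgroup Lambda)]%classic
      & forall w : subg (special_subgroup Lambda), exists h : subg H, f h = w].
Proof.
pose W := coxeter_group Gamma.
pose K := special_subgroup (central_complement Gamma).
exists (Inn W : groupClosed (Aut W)), (central_complement Gamma).
exists (@inner_retract Gamma : {multiplicative subg (Inn W) -> subg K}).
(* [Out] is by definition the set of left cosets of [Inn], so the finite index is [Out_finite]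
   itself. *)
split=> //.
- exact: full_central_complement.
- exact: infinite_special.
(* Conjugation by [w] is a preimage, since the retraction fixes [K] pointwise. *)
move=> w; have Inn_w : conj_aut (subg_val w) \in Inn W.
  by apply/asboolP; exists (subg_val w).
exists (Subg Inn_w); apply: val_inj.
rewrite [LHS](@inner_retractE _ _ (subg_val w)) //.
by apply: retract_id; exact: subg_mem.
Qed.
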